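(* Let $\lambda\in\mathbb{R}$. For all $m,k\in\mathbb{Z}$ with $m,k\ge 0$, $$S_{1,\lambda}(m+k+1,m)=-\sum_{l=0}^{m}(k+l-l\lambda)S_{1,\lambda}(k+l,l).$$
   Context: For $\lambda\in\mathbb{R}$, the generalized falling factorials are $(x)_{0,\lambda}=1$, $(x)_{n,\lambda}=x(x-\lambda)\cdots(x-(n-1)\lambda)$ for $n\ge 1$, and the ordinary falling factorials are $(x)_{0}=1$, $(x)_{n}=x(x-1)\cdots(x-n+1)$ for $n\ge 1$. The degenerate Stirling numbers of the first kind $S_{1,\lambda}(n,k)$, $0\le k\le n$, are defined by the polynomial identity $(x)_{n}=\sum_{k=0}^{n}S_{1,\lambda}(n,k)(x)_{k,\lambda}$ for $n\ge 0$. *)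

(* Defs.v *)
From mathcomp Require Import all_boot all_order all_algebra reals.

Set Implicit Arguments.
Unset Strict Implicit.
Unset Printing Implicit Defensive.

Import GRing.Theory.
Local Open Scope ring_scope.

Section DegenerateStirling.
Variable R : comNzRingType.
Implicit Types (lambda : R) (S : nat -> nat -> R) (p : {poly R}).

Definition falling_poly n : {poly R} :=
  \prod_(i < n) ('X - (i%:R)%:P).

Definition gen_falling_poly lambda n : {poly R} :=
  \prod_(i < n) ('X - (i%:R * lambda)%:P).

(* S n k is constrained only for k <= n, where it is determined uniquely: see
   the existence and uniqueness lemmas below. *)
Definition degenerate_stirling1 lambda S : Prop :=
  forall n, falling_poly n = \sum_(k < n.+1) S n k *: gen_falling_poly lambda k.

Lemma monic_gen_falling_poly lambda n : gen_falling_poly lambda n \is monic.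
Proof. exact: monic_prod_XsubC. Qed.

Lemma size_gen_falling_poly lambda n : size (gen_falling_poly lambda n) = n.+1.
Proof.
by rewrite size_prod_XsubC /index_enum -enumT size_enum_ord.
Qed.

Lemma coef_gen_falling_poly lambda n : (gen_falling_poly lambda n)`_n = 1.
Proof.
by have /monicP := monic_gen_falling_poly lambda n;
  rewrite lead_coefE size_gen_falling_poly.
Qed.

Lemma gen_falling_poly_span lambda n p : (size p <= n)%N ->
  {c : nat -> R | p = \sum_(k < n) c k *: gen_falling_poly lambda k}.
Proof.
elim: n p => [|n IHn] p szp.
  exists (fun=> 0); rewrite big_ord0.
  by apply/eqP; rewrite -size_poly_leq0.
have [|c Dc] := IHn (p - p`_n *: gen_falling_poly lambda n).
  apply/leq_sizeP => j; rewrite leq_eqVlt => /predU1P[<-|ltnj].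
    by rewrite coefB coefZ coef_gen_falling_poly mulr1 subrr.
  rewrite coefB coefZ nth_default ?(leq_trans szp) //.
  by rewrite [X in _ * X]nth_default ?size_gen_falling_poly // mulr0 subr0.
exists (fun k => if k == n then p`_n else c k).
rewrite big_ord_recr /= eqxx; apply/eqP; rewrite -subr_eq Dc; apply/eqP.
by apply: eq_bigr => i _; rewrite ltn_eqF.
Qed.

Lemma gen_falling_poly_free lambda n (c d : nat -> R) :
    \sum_(k < n) c k *: gen_falling_poly lambda k
      = \sum_(k < n) d k *: gen_falling_poly lambda k ->
  forall k, (k < n)%N -> c k = d k.
Proof.
elim: n => // n IHn; rewrite !big_ord_recr /= => Ecd.
have low (e : nat -> R) :
    (\sum_(k < n) e k *: gen_falling_poly lambda k)`_n = 0.
  rewrite coef_sum big1 // => i _.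
  by rewrite coefZ nth_default ?size_gen_falling_poly // mulr0.
have Ecdn: c n = d n.
  have /(congr1 (fun p : {poly R} => p`_n)) := Ecd.
  by rewrite !coefD !low !coefZ coef_gen_falling_poly !mulr1 !add0r.
move=> k; rewrite ltnS leq_eqVlt => /predU1P[-> // | ltkn].
by apply: IHn => //; move: Ecd; rewrite Ecdn => /addIr.
Qed.

Lemma degenerate_stirling1_exists lambda : {S | degenerate_stirling1 lambda S}.
Proof.
have szf n : (size (falling_poly n) <= n.+1)%N.
  by rewrite size_prod_XsubC /index_enum -enumT size_enum_ord.
exists (fun n => sval (gen_falling_poly_span lambda (szf n))) => n.
exact: svalP (gen_falling_poly_span lambda (szf n)).
Qed.

Lemma degenerate_stirling1_unique lambda S S' :
  degenerate_stirling1 lambda S -> degenerate_stirling1 lambda S' ->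
  forall n k, (k <= n)%N -> S n k = S' n k.
Proof.
move=> defS defS' n k lekn.
by apply: (@gen_falling_poly_free lambda n.+1); rewrite // -defS -defS'.
Qed.

End DegenerateStirling.

(* Main.v *)
Require Import Defs.
From mathcomp Require Import all_boot all_order all_algebra reals.

Set Implicit Arguments.
Unset Strict Implicit.
Unset Printing Implicit Defensive.

Import GRing.Theory.
Local Open Scope ring_scope.

(** Multiplying [(x)_n = \sum_k S(n,k) (x)_{k,lambda}] by [x - n] gives
    [(x)_{n+1}] on the left.  On the right, since
    [x - n = (x - k lambda) + (k lambda - n)], each [(x)_{k,lambda}] becomes
    [(x)_{k+1,lambda} + (k lambda - n) (x)_{k,lambda}].  As the generalized
    falling factorials are linearly independent, comparing coefficients yields
    the triangular recurrence
      [S(n+1,k) = S(n,k-1) + (k lambda - n) S(n,k)]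
    ([degenerate_stirling1_recS], and [degenerate_stirling1_rec0] for the
    column [k = 0], where the first term is absent).

    The sum in the theorem is this recurrence unrolled along the diagonal:
    at [(m+k+1, m)] the recurrence splits off the summand [l = m] and leaves
    [S(m+k, m-1)], which is the left-hand side for [m - 1]. *)

Section Recurrence.
Variables (R : comNzRingType) (lambda : R).

Lemma falling_polyS n :
  falling_poly R n.+1 = ('X - (n%:R)%:P) * falling_poly R n.
Proof. by rewrite /falling_poly big_ord_recr mulrC. Qed.

Lemma mul_XsubC_gen_falling_poly (c : R) k :
  ('X - c%:P) * gen_falling_poly lambda k =
    gen_falling_poly lambda k.+1
    + (k%:R * lambda - c) *: gen_falling_poly lambda k.
Proof.
rewrite /gen_falling_poly big_ord_recr /= [_ * ('X - _)]mulrC -mul_polyC.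
by rewrite -mulrDl polyCB addrA subrK.
Qed.

Variables (S1 : nat -> nat -> R) (S1_def : degenerate_stirling1 lambda S1).

(** The linear independence of the generalized falling factorials compares all
    coefficients at once, hence a single formula covering the columns
    [0 <= k <= n+1].  The test [k <= n] replaces by [0] the value [S1 n n.+1],
    which is arbitrary since the defining identity involves [S1 n k] for
    [k <= n] only. *)
Lemma degenerate_stirling1_rec n k : (k <= n.+1)%N ->
  S1 n.+1 k = (if k is j.+1 then S1 n j else 0)
              + (if (k <= n)%N then (k%:R * lambda - n%:R) * S1 n k else 0).
Proof.
pose d i := (if i is j.+1 then S1 n j else 0)
            + (if (i <= n)%N then (i%:R * lambda - n%:R) * S1 n i else 0).
move=> le_k_nS; apply: (@gen_falling_poly_free R lambda n.+2 (S1 n.+1) d _ k) => //.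
rewrite -S1_def falling_polyS (S1_def n) mulr_sumr.
under eq_bigr => i _ do
  rewrite -scalerAr mul_XsubC_gen_falling_poly scalerDr scalerA.
under [RHS]eq_bigr => i _ do rewrite scalerDl.
rewrite !big_split; congr (_ + _).
  by rewrite [RHS]big_ord_recl /= scale0r add0r.
rewrite [RHS]big_ord_recr /= ltnn scale0r addr0.
by apply: eq_bigr => i _; rewrite -ltnS ltn_ord mulrC.
Qed.

Lemma degenerate_stirling1_rec0 n : S1 n.+1 0 = - n%:R * S1 n 0.
Proof. by rewrite degenerate_stirling1_rec //= mul0r sub0r add0r. Qed.

Lemma degenerate_stirling1_recS n k : (k < n)%N ->
  S1 n.+1 k.+1 = S1 n k + (k.+1%:R * lambda - n%:R) * S1 n k.+1.
Proof. by move=> ltkn; rewrite degenerate_stirling1_rec ?ltkn // ltnW. Qed.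

End Recurrence.

Theorem theorem11 (R : realType) (lambda : R) (S1 : nat -> nat -> R)
    (S1_def : degenerate_stirling1 lambda S1) (m k : nat) :
  S1 (m + k + 1)%N m =
    - \sum_(0 <= l < m.+1) ((k + l)%:R - l%:R * lambda) * S1 (k + l)%N l.
Proof.
elim: m => [|m IHm].
  by rewrite big_nat1 addn1 add0n addn0 (degenerate_stirling1_rec0 S1_def)
             mul0r subr0 mulNr.
rewrite big_nat_recr //= opprD -IHm -mulNr opprB addn1.
rewrite (degenerate_stirling1_recS S1_def); last by rewrite addSn ltnS leq_addr.
by rewrite [(k + _)%N]addnC addn1 -addSn.
Qed.
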